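(* Let $\mathbb{K}$ be a field of characteristic zero, let $n\ge 1$, and let $\sigma=(\sigma(x_1),\ldots,\sigma(x_n),\sigma(p_1),\ldots,\sigma(p_n))$ be an origin-preserving polynomial symplectomorphism of $\mathbb{K}[x_1,\ldots,x_n,p_1,\ldots,p_n]$ with Jacobian equal to $1$. Then there exists a sequence $\{\tau_k\}\subset \operatorname{TAut} P_n(\mathbb{K})$ of tame symplectomorphisms converging to $\sigma$ in the formal power series topology.
   Context: $P_n(\mathbb{K})$ is the polynomial algebra $\mathbb{K}[x_1,\ldots,x_n,p_1,\ldots,p_n]$ with the Poisson bracket (a Lie bracket satisfying the Leibniz rule) determined by $\{x_i,x_j\}=0$, $\{p_i,p_j\}=0$, $\{p_i,x_j\}=\delta_{ij}$. A polynomial symplectomorphism is an element of $\operatorname{Aut}P_n(\mathbb{K})$, i.e. a $\mathbb{K}$-algebra automorphism preserving the Poisson bracket. An endomorphism is identified with the tuple of images of the generators; it is origin-preserving if all these images have zero constant term. An automorphism of a polynomial algebra $\mathbb{K}[z_1,\dots,z_N]$ is elementary if it has the form $z_k\mapsto a z_k+f$, $z_j\mapsto z_j$ ($j\neq k$), with $a\in\mathbb{K}^\times$ and $f$ a polynomial not involving $z_k$. $\operatorname{TAut}P_n(\mathbb{K})$ (tame symplectomorphisms) is the subgroup of $\operatorname{Aut}P_n(\mathbb{K})$ generated by the linear symplectic changes of variables $(x_1,\dots,x_n,p_1,\dots,p_n)\mapsto(x_1,\dots,x_n,p_1,\dots,p_n)A$, $A\in \operatorname{Sp}(2n,\mathbb{K})$,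 and the elementary origin-preserving automorphisms that preserve the Poisson bracket. The Jacobian of an endomorphism is the determinant of the matrix of partial derivatives of the images of the generators with respect to the generators. Topology: the height $\operatorname{Ht}(f)$ of a polynomial is the smallest $k$ such that its homogeneous component of total degree $k$ is nonzero ($\operatorname{Ht}(0)=\infty$); the height of a tuple of polynomials is the minimum of the heights of its entries. The formal power series topology is given by the metric $d(\varphi,\psi)=\exp(-\operatorname{Ht}(\varphi-\psi))$. *)

(* Defs.v *)
From Stdlib Require Import Rdefinitions Raxioms Rtrigo_def Rseries.
From HB Require Import structures.
From mathcomp Require Import all_boot all_order all_algebra.
From mathcomp Require Import mpoly ring.

Set Implicit Arguments.
Unset Strict Implicit.
Unset Printing Implicit Defensive.

Import GRing.Theory.
Local Open Scope ring_scope.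

Notation endo K N := (N.-tuple {mpoly K[N]}).

Section Endomorphisms.
Variables (K : fieldType) (N : nat).
Implicit Types (phi psi : endo K N) (f : {mpoly K[N]}).

(* The algebra endomorphism sending 'X_i to [tnth phi i]. *)
Definition endo_app phi f : {mpoly K[N]} := f \mPo phi.

Definition endo_id : endo K N := [tuple 'X_i | i < N].

(* [endo_app (endo_comp phi psi)] is the map [endo_app phi \o endo_app psi]. *)
Definition endo_comp phi psi : endo K N := [tuple endo_app phi (tnth psi i) | i < N].

Definition endo_sub phi psi : endo K N := [tuple tnth phi i - tnth psi i | i < N].

Definition automorphism phi : Prop := bijective (endo_app phi).

Definition origin_preserving phi : Prop := forall i, (tnth phi i)@_0%MM = 0.

Definition Jacobian phi : {mpoly K[N]} :=
  \det (\matrix_(i < N, j < N) (tnth phi i)^`M(j)).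

Definition elementary phi : Prop :=
  exists (k : 'I_N) (a : K) (f : {mpoly K[N]}),
    [/\ a != 0,
        forall m, m \in msupp f -> m k = 0%N
      & phi = [tuple if j == k then a *: 'X_k + f else 'X_j | j < N]].

(* The change of variables (z_1, ..., z_N) |-> (z_1, ..., z_N) A. *)
Definition linear_change (A : 'M[K]_N) : endo K N :=
  [tuple \sum_(i < N) A i j *: 'X_i | j < N].

(* The smallest [k] such that the component of degree [k] of [f] is nonzero;
   [None] stands for infinity.  Only degrees below [msize f] can occur. *)
Definition height f : option nat :=
  let k := find (fun k => pihomog mdeg k f != 0) (iota 0 (msize f)) in
  if (k < msize f)%N then Some k else None.

Definition min_height (h1 h2 : option nat) : option nat :=
  match h1, h2 with
  | None, h | h, None => h
  | Some k1, Some k2 => Some (minn k1 k2)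
  end.

Definition height_tuple phi : option nat :=
  \big[min_height/None]_(i < N) height (tnth phi i).

Definition dist phi psi : R :=
  match height_tuple (endo_sub phi psi) with
  | Some k => exp (Ropp (INR k))
  | None => IZR 0
  end.

Definition converges_to (tau : nat -> endo K N) phi : Prop :=
  Un_cv (fun k => dist (tau k) phi) (IZR 0).

End Endomorphisms.

Section Poisson.
Variables (K : fieldType) (n : nat).
Implicit Types (phi psi : endo K (n + n)) (f g h : {mpoly K[n + n]}).

(* The generators are ordered (x_1, ..., x_n, p_1, ..., p_n). *)
Definition ix (i : 'I_n) : 'I_(n + n) := lshift n i.
Definition ip (i : 'I_n) : 'I_(n + n) := rshift n i.

(* The biderivation with {p_i, x_j} = delta_ij (sign convention opposite to
   the one with {x_i, p_j} = delta_ij). *)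
Definition bracket f g : {mpoly K[n + n]} :=
  \sum_(i < n) (f^`M(ip i) * g^`M(ix i) - f^`M(ix i) * g^`M(ip i)).

Definition preserves_bracket phi : Prop :=
  forall f g, endo_app phi (bracket f g) = bracket (endo_app phi f) (endo_app phi g).

Definition symplectomorphism phi : Prop := automorphism phi /\ preserves_bracket phi.

Definition symplectic (A : 'M[K]_(n + n)) : Prop :=
  let J := block_mx 0 1%:M (- 1%:M) 0 in A^T *m J *m A = J.

(* The group generated by linear and elementary symplectomorphisms; the other
   constructors close it under the group operations. *)
Inductive tame : endo K (n + n) -> Prop :=
| tame_linear A : symplectic A -> tame (linear_change A)
| tame_elementary phi :
    elementary phi -> origin_preserving phi -> symplectomorphism phi -> tame phi
| tame_id : tame (endo_id K (n + n))
| tame_comp phi psi : tame phi -> tame psi -> tame (endo_comp phi psi)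
| tame_inv phi psi :
    tame phi -> endo_comp phi psi = endo_id K (n + n) ->
    endo_comp psi phi = endo_id K (n + n) -> tame psi.

End Poisson.

Section Facts.
Variables (K : fieldType).

Lemma endo_app_comp N (phi psi : endo K N) f :
  endo_app (endo_comp phi psi) f = endo_app phi (endo_app psi f).
Proof.
rewrite /endo_app [f \mPo psi]comp_mpolyE raddf_sum /= comp_mpolyE.
apply: eq_bigr => m _; rewrite linearZ /= rmorph_prod /=; congr (_ *: _).
by apply: eq_bigr => i _; rewrite rmorphXn /= tnth_mktuple.
Qed.

Lemma height_Some N (f : {mpoly K[N]}) k :
  height f = Some k <->
  pihomog mdeg k f != 0 /\ forall j, (j < k)%N -> pihomog mdeg j f = 0.
Proof.
have big j : (msize f <= j)%N -> pihomog mdeg j f = 0.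
  move=> le_fj; rewrite pihomogE big_seq_cond big1 // => m /andP[fm /eqP dm].
  by have := msize_mdeg_lt fm; rewrite dm ltnNge le_fj.
rewrite /height; set a := fun j => _; set s := iota _ _.
have below j : (j < find a s)%N -> (j < msize f)%N -> pihomog mdeg j f = 0.
  move=> lt_j lt_jf; have := before_find 0%N lt_j.
  by rewrite nth_iota //= => /negbFE/eqP.
have found : (find a s < msize f)%N -> a (find a s).
  move=> lt_f; have /(nth_find 0%N) : has a s by rewrite has_find size_iota.
  by rewrite nth_iota.
split=> [|[nz_k min_k]].
  case: ifP => // lt_f [<-]; split=> [|j lt_j]; first exact: found.
  by apply: below => //; apply: ltn_trans lt_f.
have lt_kf : (k < msize f)%N by rewrite ltnNge; apply: contra nz_k => /big ->.
have le_fk : (find a s <= k)%N.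
  by rewrite leqNgt; apply/negP => /below/(_ lt_kf)/eqP; apply/negP.
have lt_f := leq_ltn_trans le_fk lt_kf; rewrite lt_f; congr Some.
apply/eqP; rewrite eqn_leq le_fk leqNgt; apply/negP => /min_k/eqP.
exact/negP/found.
Qed.

Lemma height_None N (f : {mpoly K[N]}) : height f = None <-> f = 0.
Proof.
split=> [|->]; last by rewrite /height msize0.
rewrite /height; case: ifP => // /negbT; rewrite -leqNgt => le_f _.
rewrite (pihomog_partitionE (leqnn (msize f))) big1 // => j _.
have lt_j : (j < find (fun k => pihomog mdeg k f != 0%R) (iota 0 (msize f)))%N.
  exact: leq_trans le_f.
by have := before_find 0%N lt_j; rewrite nth_iota //= => /negbFE/eqP.
Qed.

Variable n : nat.
Implicit Types f g h : {mpoly K[n + n]}.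

Lemma mderiv_var N (i j : 'I_N) : ('X_i : {mpoly K[N]})^`M(j) = (i == j)%:R.
Proof.
rewrite mderivX mnm1E; case: eqVneq => [->|_]; last by rewrite scale0r.
have -> : (U_(j) - U_(j) = 0)%MM by apply/mnmP => k; rewrite mnmBE subnn mnm0E.
by rewrite mpolyX0 scale1r.
Qed.

Lemma bracket_px i j : bracket 'X_(ip i) 'X_(ix j) = (i == j)%:R :> {mpoly K[n + n]}.
Proof.
rewrite /bracket (bigD1 i) //= big1 => [|k ne_ki]; rewrite !mderiv_var /ip /ix.
  by rewrite eqxx eq_rlshift eq_lshift eq_sym mul1r mul0r subr0 addr0.
by rewrite eq_rlshift eq_rshift eq_sym (negPf ne_ki) !mul0r subr0.
Qed.

Lemma bracket_xx i j : bracket 'X_(ix i) 'X_(ix j) = 0 :> {mpoly K[n + n]}.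
Proof.
by rewrite /bracket big1 // => k _; rewrite !mderiv_var !eq_lrshift mul0r mulr0 subr0.
Qed.

Lemma bracket_pp i j : bracket 'X_(ip i) 'X_(ip j) = 0 :> {mpoly K[n + n]}.
Proof.
by rewrite /bracket big1 // => k _; rewrite !mderiv_var !eq_rlshift mul0r mulr0 subr0.
Qed.

Lemma bracketC f g : bracket f g = - bracket g f.
Proof.
rewrite /bracket -sumrN; apply: eq_bigr => i _.
by rewrite opprB [g^`M(_) * _]mulrC [X in _ = _ - X]mulrC.
Qed.

Lemma bracketM f g h : bracket f (g * h) = bracket f g * h + g * bracket f h.
Proof.
rewrite /bracket mulr_suml mulr_sumr -big_split; apply: eq_bigr => i _ /=.
by rewrite !mderivM; ring.
Qed.

End Facts.

(* Main.v *)
(** Composing with the inverse of its (symplectic) linear part, and then with inverses of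
    tame symplectomorphisms already found, reduces to a bracket-preserving map
    [rho = id + g] with [g] of order [a >= 2].  Modulo order [a + 1], preservation of the
    bracket says that [g] is a closed 1-form, hence [g = {F, _}] with [F] of degree [a + 1]
    (Poincare lemma).  [F] is a sum of scaled powers of linear forms [l], because a monomial
    of degree [d] is an iterated finite difference of [w |-> w ^ d] at any base point.
    Taking a variable [p_1] as base point, each such [l] is the image of [x_1] under a
    symplectic transvection, which conjugates an elementary map
    [p_1 |-> p_1 - c x_1 ^ a] into the time-one flow of a multiple of [l ^ (a + 1)].
    Composing these flows gives a tame map that agrees with [rho] modulo order [a + 1]. *)

Require Import Defs.
From Stdlib Require Import Rdefinitions RIneq Rbasic_fun Rfunctions Rtrigo_def Exp_prop.
From Stdlib Require Import Rpower IndefiniteDescription.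
From HB Require Import structures.
From mathcomp Require Import all_boot all_order all_algebra.
From mathcomp Require Import mpoly ring.

Set Implicit Arguments.
Unset Strict Implicit.
Unset Printing Implicit Defensive.

Import GRing.Theory.
Local Open Scope ring_scope.

(** * Order of vanishing at the origin, and its behaviour under endomorphisms *)

Section Order.
Variables (K : fieldType) (N : nat).
Implicit Types (f g : {mpoly K[N]}) (phi : endo K N).

(** Membership in the [d]-th power of the ideal of the origin; equivalently height at least [d],
    with [f = 0] satisfying it for every [d]. *)
Definition ord_ge d f := forall m, (mdeg m < d)%N -> f@_m = 0.

Lemma ord_ge_le d e f : (d <= e)%N -> ord_ge e f -> ord_ge d f.
Proof. by move=> de fe m md; apply: fe; apply: leq_trans de. Qed.

Lemma ord_ge0 d : ord_ge d 0.
Proof. by move=> m _; rewrite mcoeff0. Qed.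

Lemma ord_geD d f g : ord_ge d f -> ord_ge d g -> ord_ge d (f + g).
Proof. by move=> fd gd m md; rewrite mcoeffD fd // gd // addr0. Qed.

Lemma ord_geZ d c f : ord_ge d f -> ord_ge d (c *: f).
Proof. by move=> fd m md; rewrite mcoeffZ fd // mulr0. Qed.

Lemma ord_geN d f : ord_ge d f -> ord_ge d (- f).
Proof. by move=> fd m md; rewrite mcoeffN fd // oppr0. Qed.

Lemma ord_geB d f g : ord_ge d f -> ord_ge d g -> ord_ge d (f - g).
Proof. by move=> fd gd; apply: ord_geD => //; apply: ord_geN. Qed.

Lemma ord_ge_sum d (I : Type) (r : seq I) (P : pred I) (F : I -> {mpoly K[N]}) :
  (forall i, P i -> ord_ge d (F i)) -> ord_ge d (\sum_(i <- r | P i) F i).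
Proof. by move=> Fd; apply: big_ind => //; [exact: ord_ge0|exact: ord_geD]. Qed.

Lemma ord_geM d e f g : ord_ge d f -> ord_ge e g -> ord_ge (d + e) (f * g).
Proof.
move=> fd ge m md; rewrite mcoeffM big1 // => -[k1 k2] /= /eqP/(congr1 (@mdeg N)).
rewrite mdegD => mE; have [k1d|k1d] := ltnP (mdeg k1) d; first by rewrite fd // mul0r.
rewrite ge ?mulr0 // -(ltn_add2l (mdeg k1)) -mE.
by apply: leq_trans md _; rewrite leq_add2r.
Qed.

Lemma ord_ge_exp d f k : ord_ge d f -> ord_ge (k * d) (f ^+ k).
Proof.
move=> fd; elim: k => [|k IHk]; first by move=> m; rewrite mul0n.
by rewrite exprS mulSn; apply: ord_geM.
Qed.

Lemma ord_geX m : ord_ge (mdeg m) 'X_[K, m].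
Proof. by move=> k; rewrite mcoeffX; case: eqP => // ->; rewrite ltnn. Qed.

Lemma ord_ge_var i : ord_ge 1 ('X_i : {mpoly K[N]}).
Proof. by rewrite -(mdeg1 i); apply: ord_geX. Qed.

Lemma ord_ge_mderiv d f i : ord_ge d.+1 f -> ord_ge d f^`M(i).
Proof. by move=> fd m md; rewrite mcoeff_deriv fd ?mul0rn // mdegD mdeg1 addn1. Qed.

Lemma origin_preservingP phi :
  origin_preserving phi <-> forall i, ord_ge 1 (tnth phi i).
Proof.
split=> [p0 i m|p1 i]; last by apply: p1; rewrite mdeg0.
by rewrite ltnS leqn0 mdeg_eq0 => /eqP->.
Qed.

Lemma endo_appX phi i : endo_app phi 'X_i = tnth phi i.
Proof.
rewrite /endo_app comp_mpolyX (bigD1 i) //= big1 ?mulr1 => [|j ji].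
  by rewrite mnm1E eqxx expr1.
by rewrite mnm1E eq_sym (negPf ji) expr0.
Qed.

Lemma mpolyX_ind (P : 'X_{1..N} -> Prop) :
  P 0%MM -> (forall i m, P m -> P (U_(i) + m)%MM) -> forall m, P m.
Proof.
move=> P0 PS m; have [d] := ubnP (mdeg m); elim: d m => // d IHd m md.
have [/eqP|] := eqVneq (mdeg m) 0%N; first by rewrite mdeg_eq0 => /eqP->.
rewrite mdeg_eq0 => m0.
have [i mi] : exists i, (0 < m i)%N.
  apply/existsP; apply: contraR m0; rewrite negb_exists => /forallP m0.
  by apply/eqP/mnmP => i; rewrite mnm0E; apply/eqP; rewrite -leqn0 leqNgt.
have mE : m = (U_(i) + (m - U_(i)))%MM.
  by rewrite addmC submK //; apply/mnm_lepP => j; rewrite mnm1E; case: eqP => // <-.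
rewrite mE; apply/PS/IHd; move: md.
by rewrite {1}mE mdegD mdeg1 add1n ltnS.
Qed.

Lemma mpolyX_ord_ind d (P : {mpoly K[N]} -> Prop) f :
    P 0 -> (forall g h, P g -> P h -> P (g + h)) ->
    (forall c m, (d <= mdeg m)%N -> P (c *: 'X_[m])) ->
  ord_ge d f -> P f.
Proof.
move=> P0 PD PX fd; rewrite [f]mpolyE big_seq; apply: big_ind => // m.
rewrite mcoeff_msupp => fm; apply: PX; rewrite leqNgt.
by apply: contra fm => /fd->.
Qed.

Lemma mpoly_alg_ind (P : {mpoly K[N]} -> Prop) :
    (forall c, P c%:MP) -> (forall i, P 'X_i) ->
    (forall f g, P f -> P g -> P (f + g)) ->
    (forall f g, P f -> P g -> P (f * g)) -> forall f, P f.
Proof.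
move=> PC PX PD PM f; apply: (@mpolyX_ord_ind 0) => // [|c m _].
  by rewrite -(mpolyC0 N K).
rewrite -mul_mpolyC; apply: (PM) => //; elim/mpolyX_ind: m => [|i m IHm].
  by rewrite mpolyX0 -mpolyC1.
by rewrite mpolyXD; apply: PM.
Qed.

Lemma ord_ge_app phi d f :
  origin_preserving phi -> ord_ge d f -> ord_ge d (endo_app phi f).
Proof.
move=> /origin_preservingP phi0.
have appX m : ord_ge (mdeg m) (endo_app phi 'X_[m]).
  elim/mpolyX_ind: m => [|i m IHm]; first by rewrite mdeg0.
  rewrite mpolyXD mdegD mdeg1 /endo_app rmorphM /=.
  by apply: ord_geM => //; rewrite -/(endo_app phi 'X_i) endo_appX.
apply: (@mpolyX_ord_ind d (fun f => ord_ge d (endo_app phi f))) =>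
  [|g h gd hd|c m dm].
- by rewrite /endo_app raddf0; apply: ord_ge0.
- by rewrite /endo_app raddfD; apply: ord_geD.
by rewrite /endo_app linearZ /=; apply/ord_geZ/(ord_ge_le dm).
Qed.

(** In a monomial, replace the variables by their images one at a time: each replacement trades a
    factor of degree one for an increment of order [a]. Positivity of [a] makes the images vanish at
    the origin, so factors already replaced keep their order. *)
Lemma ord_ge_app_sub phi a b f : (0 < a)%N ->
    (forall i, ord_ge a (tnth phi i - 'X_i)) ->
  ord_ge b f -> ord_ge (b + a).-1 (endo_app phi f - f).
Proof.
case: a => // a _ phia; rewrite addnS /=.
have phi1 i : ord_ge 1 (tnth phi i).
  rewrite -[tnth phi i](subrK 'X_i); apply: ord_geD; last exact: ord_ge_var.
  exact: ord_ge_le (phia i).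
have appX m : ord_ge (mdeg m + a) (endo_app phi 'X_[m] - 'X_[m]).
  elim/mpolyX_ind: m => [|i m IHm].
    by rewrite mpolyX0 /endo_app rmorph1 subrr; apply: ord_ge0.
  have -> : endo_app phi 'X_[U_(i) + m] - 'X_[U_(i) + m] =
      tnth phi i * (endo_app phi 'X_[m] - 'X_[m]) + (tnth phi i - 'X_i) * 'X_[m].
    by rewrite mpolyXD /endo_app rmorphM /= -!/(endo_app phi _) endo_appX; ring.
  rewrite mdegD mdeg1 add1n addSn; apply: ord_geD.
    by rewrite -add1n; apply: ord_geM.
  by rewrite addnC -addSn; apply: ord_geM => //; apply: ord_geX.
apply: (@mpolyX_ord_ind b (fun f => ord_ge (b + a) (endo_app phi f - f))) =>
  [|g h gd hd|c m dm].
- by rewrite /endo_app raddf0 subrr; apply: ord_ge0.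
- rewrite /endo_app raddfD /= -!/(endo_app phi _) opprD addrACA; exact: ord_geD.
rewrite /endo_app linearZ /= -scalerBr; apply: ord_geZ.
by apply: (ord_ge_le _ (appX m)); rewrite leq_add2r.
Qed.

(* Euler's formula [\sum_i z_i d_i f = a f] for the homogeneous component of degree [a]. *)
Lemma ord_ge_euler a f :
  ord_ge a f -> ord_ge a.+1 (\sum_i 'X_i * f^`M(i) - f *+ a).
Proof.
apply: (@mpolyX_ord_ind a (fun f => ord_ge a.+1 (\sum_i 'X_i * f^`M(i) - f *+ a)))
  => [|g h ga ha|c m am].
- rewrite mul0rn subr0; apply: ord_ge_sum => i _.
  by rewrite mderiv0 mulr0; apply: ord_ge0.
- have -> : \sum_i 'X_i * (g + h)^`M(i) - (g + h) *+ a =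
     (\sum_i 'X_i * g^`M(i) - g *+ a) + (\sum_i 'X_i * h^`M(i) - h *+ a).
    rewrite addrACA -big_split -opprD -mulrnDl; congr (_ - _).
    by apply: eq_bigr => i _; rewrite mderivD mulrDr.
  exact: ord_geD.
have XM i : 'X_i * (c *: 'X_[m])^`M(i) = (c *: 'X_[m]) *+ m i.
  rewrite mderivZ mderivX -!scalerAr scalerMnr; congr (_ *: _).
  have [->|mi] := posnP (m i); first by rewrite scale0r mulr0n.
  rewrite scaler_nat -mpolyXD addmC submK //; apply/mnm_lepP => j.
  by rewrite mnm1E; case: eqP => // <-.
under eq_bigr do rewrite XM.
rewrite sumrMnr -mdegE -mulrnBr //.
have [<-|ma] := eqVneq a (mdeg m); first by rewrite subnn mulr0n; apply: ord_ge0.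
rewrite -scaler_nat; apply/ord_geZ/ord_geZ.
by apply: ord_ge_le (@ord_geX m); rewrite ltn_neqAle ma.
Qed.

Lemma endo_comp_id phi psi :
  (forall i, endo_app phi (tnth psi i) = 'X_i) -> endo_comp phi psi = endo_id K N.
Proof. by move=> h; apply: eq_from_tnth => i; rewrite !tnth_mktuple. Qed.

Lemma endo_app_id f : endo_app (endo_id K N) f = f.
Proof. exact: comp_mpoly_id. Qed.

Lemma endo_appK phi psi : endo_comp phi psi = endo_id K N ->
  cancel (endo_app psi) (endo_app phi).
Proof. by move=> h f; rewrite -endo_app_comp h endo_app_id. Qed.

End Order.

(** * The Poisson bracket with a uniform index, and elementary symplectomorphisms *)

Section Bracket.
Variables (K : fieldType) (n : nat).
Implicit Types (f g h F : {mpoly K[n + n]}) (phi psi : endo K (n + n)).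
Implicit Types (i j k : 'I_(n + n)) (A : 'M[K]_(n + n)).

(** Exchanging [x_a] and [p_a], up to a sign, lets one index run over both halves of the variables:
    [{f, z_k}] is [conj_sign k] times the derivative of [f] in the conjugate variable. *)
Definition conj_ix i : 'I_(n + n) :=
  match split i with inl a => ip a | inr a => ix a end.

Definition conj_sign i : K := if split i is inl _ then 1 else -1.

Lemma conj_ix_x (a : 'I_n) : conj_ix (ix a) = ip a.
Proof. by rewrite /conj_ix /ix (unsplitK (inl a)). Qed.

Lemma conj_ix_p (a : 'I_n) : conj_ix (ip a) = ix a.
Proof. by rewrite /conj_ix /ip (unsplitK (inr a)). Qed.

Lemma conj_sign_x (a : 'I_n) : conj_sign (ix a) = 1.
Proof. by rewrite /conj_sign /ix (unsplitK (inl a)). Qed.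

Lemma conj_sign_p (a : 'I_n) : conj_sign (ip a) = -1.
Proof. by rewrite /conj_sign /ip (unsplitK (inr a)). Qed.

Lemma ix_ip_ind (P : 'I_(n + n) -> Prop) :
  (forall a, P (ix a)) -> (forall a, P (ip a)) -> forall i, P i.
Proof. by move=> Px Pp i; case: (split_ordP i) => a ->; [apply: Px|apply: Pp]. Qed.

Lemma conj_ixK : involutive conj_ix.
Proof. by elim/ix_ip_ind => a; rewrite !(conj_ix_x, conj_ix_p). Qed.

Lemma conj_sign_conj i : conj_sign (conj_ix i) = - conj_sign i.
Proof.
elim/ix_ip_ind: i => a; rewrite !(conj_ix_x, conj_ix_p, conj_sign_x, conj_sign_p) //.
by rewrite opprK.
Qed.

Lemma conj_sign_sqr i : conj_sign i * conj_sign i = 1.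
Proof.
elim/ix_ip_ind: i => a; rewrite !(conj_sign_x, conj_sign_p) ?mulr1 //.
by rewrite mulrNN mulr1.
Qed.

Lemma conj_ix_neq i : (conj_ix i == i) = false.
Proof.
by elim/ix_ip_ind: i => a; rewrite !(conj_ix_x, conj_ix_p) ?eq_rlshift ?eq_lrshift.
Qed.

Lemma bracketE f g :
  bracket f g = \sum_k conj_sign k *: (f^`M(conj_ix k) * g^`M(k)).
Proof.
rewrite big_split_ord /= -big_split; apply: eq_bigr => a _ /=.
rewrite -/(ix a) -/(ip a) !(conj_ix_x, conj_ix_p, conj_sign_x, conj_sign_p).
by rewrite scale1r scaleN1r.
Qed.

Lemma bracket_var f i : bracket f 'X_i = conj_sign i *: f^`M(conj_ix i).
Proof.
rewrite bracketE (bigD1 i) //= big1 ?addr0 => [|k ki]; rewrite mderiv_var.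
  by rewrite eqxx mulr1.
by rewrite eq_sym (negPf ki) mulr0 scaler0.
Qed.

Lemma bracketDr f g h : bracket f (g + h) = bracket f g + bracket f h.
Proof.
rewrite !bracketE -big_split; apply: eq_bigr => k _ /=.
by rewrite mderivD mulrDr scalerDr.
Qed.

Lemma bracketZr c f g : bracket f (c *: g) = c *: bracket f g.
Proof.
rewrite !bracketE scaler_sumr; apply: eq_bigr => k _.
by rewrite mderivZ -scalerAr scalerA mulrC -scalerA.
Qed.

Lemma bracketNr f g : bracket f (- g) = - bracket f g.
Proof. by rewrite -scaleN1r bracketZr scaleN1r. Qed.

Lemma bracketBr f g h : bracket f (g - h) = bracket f g - bracket f h.
Proof. by rewrite bracketDr bracketNr. Qed.

Lemma bracketDl f g h : bracket (f + g) h = bracket f h + bracket g h.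
Proof. by rewrite bracketC bracketDr opprD -!(bracketC _ h). Qed.

Lemma bracketNl f g : bracket (- f) g = - bracket f g.
Proof. by rewrite bracketC bracketNr -(bracketC f). Qed.

Lemma bracketBl f g h : bracket (f - g) h = bracket f h - bracket g h.
Proof. by rewrite bracketDl bracketNl. Qed.

Lemma bracketZl c f g : bracket (c *: f) g = c *: bracket f g.
Proof. by rewrite bracketC bracketZr -scalerN -(bracketC f). Qed.

Lemma bracketCr f c : bracket f c%:MP = 0.
Proof. by rewrite bracketE big1 // => k _; rewrite mderivC mulr0 scaler0. Qed.

Lemma bracketff f : bracket f f = 0.
Proof. by rewrite /bracket big1 // => a _; rewrite mulrC subrr. Qed.

Lemma bracketMl f g h : bracket (f * g) h = bracket f h * g + f * bracket g h.
Proof. by rewrite bracketC bracketM opprD -mulNr -mulrN -!(bracketC _ h). Qed.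

Lemma bracket_exp f g b :
  bracket (f ^+ b.+1) g = (f ^+ b * bracket f g) *+ b.+1.
Proof.
elim: b => [|b IHb]; first by rewrite expr1 expr0 mul1r.
by rewrite exprS bracketMl IHb mulrnAr mulrA -exprS mulrC -mulrS.
Qed.

Lemma ord_ge_bracket a b f g :
  ord_ge a.+1 f -> ord_ge b.+1 g -> ord_ge (a + b) (bracket f g).
Proof.
move=> fa gb; rewrite bracketE; apply: ord_ge_sum => k _.
by apply/ord_geZ/ord_geM; apply: ord_ge_mderiv.
Qed.

Lemma bracket_vars i j :
  bracket 'X_i 'X_j = (conj_sign j * (i == conj_ix j)%:R)%:MP :> {mpoly K[n + n]}.
Proof. by rewrite bracket_var mderiv_var -mul_mpolyC mpolyCM mpolyC_nat. Qed.

(** Both sides are derivations along [phi] in each argument, so generators suffice. [ext] treats the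
    right argument for a fixed left one, and antisymmetry reuses it for the left argument. *)
Lemma preserves_bracketP phi :
  (forall i j, bracket (tnth phi i) (tnth phi j) = bracket 'X_i 'X_j) ->
  preserves_bracket phi.
Proof.
move=> phiX.
have ext u v : (forall i, endo_app phi (bracket u 'X_i) = bracket v (tnth phi i)) ->
    forall g, endo_app phi (bracket u g) = bracket v (endo_app phi g).
  move=> uv; elim/mpoly_alg_ind => [c|i|f g fE gE|f g fE gE].
  - by rewrite /endo_app comp_mpolyC !bracketCr comp_mpoly0.
  - by rewrite uv endo_appX.
  - by move: fE gE; rewrite /endo_app bracketDr !raddfD /= bracketDr => -> ->.
  move: fE gE; rewrite /endo_app bracketM raddfD /= !rmorphM /= bracketM.
  by move=> -> ->.
move=> f; apply: (ext) => i; rewrite bracketC /endo_app raddfN /= -/(endo_app _ _).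
rewrite [RHS]bracketC; congr (- _); move: f; apply: ext => j.
by rewrite phiX bracket_vars /endo_app comp_mpolyC.
Qed.

Lemma preserves_bracket_comp phi psi :
  preserves_bracket phi -> preserves_bracket psi -> preserves_bracket (endo_comp phi psi).
Proof. by move=> phiP psiP f g; rewrite !endo_app_comp psiP phiP. Qed.

Lemma origin_preserving_comp phi psi :
  origin_preserving phi -> origin_preserving psi -> origin_preserving (endo_comp phi psi).
Proof.
move=> phi0 /origin_preservingP psi0; apply/origin_preservingP => i.
by rewrite tnth_mktuple; apply: ord_ge_app.
Qed.

(** * Linear forms, symplectic matrices and tame maps with explicit inverses *)

Definition lform (u : 'I_(n + n) -> K) : {mpoly K[n + n]} := \sum_i u i *: 'X_i.

Lemma lform_mderiv u k : (lform u)^`M(k) = (u k)%:MP.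
Proof.
rewrite raddf_sum (bigD1 k) //= big1 ?addr0 => [|i ik]; rewrite mderivZ mderiv_var.
  by rewrite eqxx -mul_mpolyC mulr1.
by rewrite (negPf ik) scaler0.
Qed.

Lemma eq_lform u v : u =1 v -> lform u = lform v.
Proof. by move=> uv; apply: eq_bigr => i _; rewrite uv. Qed.

Lemma lformD u v : lform u + lform v = lform (fun i => u i + v i).
Proof. by rewrite -big_split; apply: eq_bigr => i _; rewrite scalerDl. Qed.

Lemma lformZ c u : c *: lform u = lform (fun i => c * u i).
Proof. by rewrite scaler_sumr; apply: eq_bigr => i _; rewrite scalerA. Qed.

Lemma lform_var i : lform (fun k => (k == i)%:R) = 'X_i.
Proof.
rewrite /lform (bigD1 i) //= big1 ?addr0 => [|k ki]; first by rewrite eqxx scale1r.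
by rewrite (negPf ki) scale0r.
Qed.

Lemma ord_ge_lform u : ord_ge 1 (lform u).
Proof. by apply: ord_ge_sum => i _; apply/ord_geZ/ord_ge_var. Qed.

Lemma endo_app_lform phi u : endo_app phi (lform u) = \sum_i u i *: tnth phi i.
Proof.
rewrite /endo_app raddf_sum; apply: eq_bigr => i _ /=.
by rewrite linearZ /= -/(endo_app _ _) endo_appX.
Qed.

Lemma tnth_linear_change A j : tnth (linear_change A) j = lform (A^~ j).
Proof. by rewrite tnth_mktuple. Qed.

Lemma bracket_lform u v :
  bracket (lform u) (lform v) = (\sum_k conj_sign k * (u (conj_ix k) * v k))%:MP.
Proof.
rewrite bracketE raddf_sum; apply: eq_bigr => k _ /=.
by rewrite !lform_mderiv -mpolyCM -mul_mpolyC -mpolyCM.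
Qed.

Lemma bracket_lformr f u :
  bracket f (lform u) = \sum_i u i *: bracket f 'X_i.
Proof.
rewrite /lform; elim/big_rec2: _ => [|i x y _ <-].
  by rewrite -(mpolyC0 _ K) bracketCr.
by rewrite bracketDr bracketZr.
Qed.

(** Since [{p_a, x_a} = 1], [J] is minus the matrix of brackets of the variables, and [A^T J A] is
    minus the matrix of brackets of the columns of [A] read as linear forms; the signs cancel. *)
Lemma symplecticP A :
  symplectic A <->
  forall i j, bracket (lform (A^~ i)) (lform (A^~ j)) = bracket 'X_i 'X_j.
Proof.
set J : 'M[K]_(n + n) := block_mx 0 1%:M (- 1%:M) 0.
have JE i j : J i j = - (conj_sign j * (i == conj_ix j)%:R).
  elim/ix_ip_ind: i => a; elim/ix_ip_ind: j => b;
  rewrite !(conj_ix_x, conj_ix_p, conj_sign_x, conj_sign_p) /J /ix /ip.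
  - by rewrite block_mxEul mxE eq_lrshift mulr0 oppr0.
  - by rewrite block_mxEur mxE eq_lshift mulN1r opprK.
  - by rewrite block_mxEdl !mxE eq_rshift mul1r.
  - by rewrite block_mxEdr mxE eq_rlshift mulr0 oppr0.
have AJA i j : (A^T *m J *m A) i j =
    - \sum_k conj_sign k * (A (conj_ix k) i * A k j).
  rewrite mxE -sumrN; apply: eq_bigr => k _; rewrite mxE (bigD1 (conj_ix k)) //=.
  rewrite big1 ?addr0 => [|l lk]; rewrite mxE JE.
    by rewrite eqxx mulr1 mulrN mulNr mulrCA mulrA.
  by rewrite (negPf lk) mulr0 oppr0 mulr0.
rewrite /symplectic -/J; split=> [/matrixP AJ i j|AJ].
  by rewrite bracket_lform bracket_vars; congr (_%:MP); apply: oppr_inj;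
     rewrite -AJA -JE.
apply/matrixP => i j; rewrite AJA JE; congr (- _).
have /(congr1 (mcoeff 0%MM)) := AJ i j.
by rewrite bracket_lform bracket_vars !mpolyCK.
Qed.

Lemma linear_change_bracket A : symplectic A -> preserves_bracket (linear_change A).
Proof.
move=> /symplecticP AP; apply: preserves_bracketP => i j.
by rewrite !tnth_linear_change.
Qed.

(** Keeping the inverse as data allows tame maps to be conjugated and peeled off; that [psi] is tame
    and preserves the bracket follows by cancellation. *)
Record tame_inverse phi psi : Prop := TameInverse {
  tame_inverse_tame : tame phi;
  tame_inverse_bracket : preserves_bracket phi;
  tame_inverse_originl : origin_preserving phi;
  tame_inverse_originr : origin_preserving psi;
  tame_inverseV : endo_comp phi psi = endo_id K (n + n);
  tame_inverseK : endo_comp psi phi = endo_id K (n + n) }.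

Lemma tame_inverse_sym phi psi : tame_inverse phi psi -> tame_inverse psi phi.
Proof.
case=> phiT phiB phi0 psi0 phiV phiK.
split; [exact: (tame_inv phiT phiV phiK)| |exact: psi0|exact: phi0|exact: phiK|exact: phiV].
move=> f g; apply: (can_inj (endo_appK phiK)).
by rewrite phiB !(endo_appK phiV).
Qed.

Lemma tame_inverse_id : tame_inverse (endo_id K (n + n)) (endo_id K (n + n)).
Proof.
have id0 : origin_preserving (endo_id K (n + n)).
  by apply/origin_preservingP => i; rewrite tnth_mktuple; apply: ord_ge_var.
split=> //; first exact: tame_id.
- by move=> f g; rewrite !endo_app_id.
- by apply: endo_comp_id => i; rewrite endo_app_id tnth_mktuple.
by apply: endo_comp_id => i; rewrite endo_app_id tnth_mktuple.
Qed.

Lemma tame_inverse_comp phi1 psi1 phi2 psi2 :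
  tame_inverse phi1 psi1 -> tame_inverse phi2 psi2 ->
  tame_inverse (endo_comp phi1 phi2) (endo_comp psi2 psi1).
Proof.
case=> T1 B1 phi10 psi10 V1 K1 [T2 B2 phi20 psi20 V2 K2]; split.
- exact: tame_comp.
- exact: preserves_bracket_comp.
- exact: origin_preserving_comp.
- exact: origin_preserving_comp.
- apply: endo_comp_id => i; rewrite tnth_mktuple endo_app_comp (endo_appK V2).
  by rewrite -endo_appX (endo_appK V1).
apply: endo_comp_id => i; rewrite tnth_mktuple endo_app_comp (endo_appK K1).
by rewrite -endo_appX (endo_appK K2).
Qed.

Lemma linear_change_tame A : symplectic A ->
  exists B, tame_inverse (linear_change A) (linear_change B).
Proof.
(* From [A^T J A = J] and [- J J = 1], the inverse of [A] is [- J A^T J]. *)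
move=> AS; set J : 'M[K]_(n + n) := block_mx 0 1%:M (- 1%:M) 0.
have JJ : - J *m J = 1%:M.
  rewrite mulNmx mulmx_block !(mulmx0, mul0mx, mul1mx, mulmx1, add0r, addr0).
  by rewrite opp_block_mx !oppr0 opprK -scalar_mx_block.
have BA : (- J *m A^T *m J) *m A = 1%:M by rewrite -!mulmxA (mulmxA A^T) AS.
exists (- J *m A^T *m J); move: (_ *m J) BA => B BA; have AB := mulmx1C BA.
have lin0 (C : 'M[K]_(n + n)) : origin_preserving (linear_change C).
  by apply/origin_preservingP => i; rewrite tnth_linear_change; apply: ord_ge_lform.
have linK (C D : 'M[K]_(n + n)) : C *m D = 1%:M ->
    endo_comp (linear_change C) (linear_change D) = endo_id K (n + n).
  move=> /matrixP CD; apply: endo_comp_id => i; rewrite tnth_linear_change.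
  rewrite endo_app_lform; under eq_bigr do rewrite tnth_linear_change /lform scaler_sumr.
  rewrite exchange_big -lform_var; apply: eq_bigr => k _ /=.
  move: (CD k i); rewrite !mxE => <-; rewrite scaler_suml.
  by apply: eq_bigr => j _; rewrite scalerA mulrC.
split; [exact: tame_linear|exact: linear_change_bracket|exact: lin0|exact: lin0| |];
exact: linK.
Qed.

(* The time-one map of the Hamiltonian flow of [F], when [F] Poisson-commutes with every
   [bracket F 'X_i]. *)
Definition kick F : endo K (n + n) := [tuple 'X_i + bracket F 'X_i | i < n + n].

(** A Hamiltonian in the single variable ['X_i] moves only the conjugate variable, by a polynomial
    in ['X_i]; hence the map is elementary, and negating [c] inverts it. *)
Lemma kick_tame c i b :
  tame_inverse (kick (c *: 'X_i ^+ b.+2)) (kick (- c *: 'X_i ^+ b.+2)).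
Proof.
have [f fE] : exists f : K -> {mpoly K[n + n]},
    forall e, f e = (conj_sign (conj_ix i) * e) *: ('X_i ^+ b.+1 *+ b.+2).
  by exists (fun e => (conj_sign (conj_ix i) * e) *: ('X_i ^+ b.+1 *+ b.+2)).
have brX j (e : K) (d : nat) : bracket (e *: ('X_i ^+ d.+1)) 'X_j =
    (j == conj_ix i)%:R *: (conj_sign (conj_ix i) * e *: ('X_i ^+ d *+ d.+1)).
  rewrite bracketZl bracket_exp bracket_vars mulrC mul_mpolyC scaler_nat.
  have -> : (i == conj_ix j) = (j == conj_ix i).
    by rewrite -(inj_eq (can_inj conj_ixK)) conj_ixK eq_sym.
  case: eqP => [->|_]; last by rewrite mulr0 scale0r mul0rn scaler0 mulr0n.
  by rewrite mulr1 mulr1n -!scalerMnr scalerA mulrC.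
have kickX e j : tnth (kick (e *: 'X_i ^+ b.+2)) j = 'X_j + (j == conj_ix i)%:R *: f e.
  by rewrite tnth_mktuple brX fE.
have f1 e : ord_ge 1 (f e).
  rewrite fE -scaler_nat; apply/ord_geZ/ord_geZ.
  by apply: (@ord_ge_le _ _ _ (b.+1 * 1)) => //; apply/ord_ge_exp/ord_ge_var.
have kick0 e : origin_preserving (kick (e *: 'X_i ^+ b.+2)).
  apply/origin_preservingP => j; rewrite kickX.
  by apply: ord_geD; [exact: ord_ge_var|exact/ord_geZ].
(* The increment is a polynomial in ['X_i], which the map fixes because no index is its own
   conjugate; so the increments for [e] and [- e] cancel. *)
have kickV e : endo_comp (kick (e *: 'X_i ^+ b.+2)) (kick (- e *: 'X_i ^+ b.+2)) =
    endo_id K (n + n).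
  apply: endo_comp_id => j; rewrite kickX !fE /endo_app raddfD /= !linearZ /=.
  rewrite raddfMn /= rmorphXn /= -!/(endo_app _ _) !endo_appX !kickX !fE.
  rewrite [i == _]eq_sym conj_ix_neq scale0r addr0 -addrA -scalerDr -scalerDl.
  by rewrite -mulrDr subrr mulr0 scale0r scaler0 addr0.
(* The increment brackets nontrivially only with the moved variable, so the two cross terms in the
   bracket of two images cancel by antisymmetry. *)
have brf j : bracket (f c) 'X_j =
    (j == conj_ix i)%:R *: bracket (f c) 'X_(conj_ix i).
  by rewrite fE -scaler_nat scalerA !brX eqxx scale1r.
have kickB : preserves_bracket (kick (c *: 'X_i ^+ b.+2)).
  apply: preserves_bracketP => j k; rewrite !kickX.
  rewrite !(bracketDl, bracketDr, bracketZl, bracketZr) bracketff !scaler0 addr0.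
  rewrite [bracket 'X_j (f c)]bracketC (brf j) (brf k) -addrA.
  by rewrite !scalerN !scalerA mulrC addNr addr0.
have kickK := kickV (- c); rewrite opprK in kickK.
split; [|exact: kickB|exact: kick0|exact: kick0|exact: kickV|exact: kickK].
apply: tame_elementary; [|exact: kick0|split; [|exact: kickB]]; last first.
  exists (endo_app (kick (- c *: 'X_i ^+ b.+2))).
    exact: endo_appK kickK.
  exact: endo_appK (kickV c).
exists (conj_ix i), 1, (f c); split; first exact: oner_neq0.
  move=> m; rewrite mcoeff_msupp fE -scaler_nat scalerA mcoeffZ mpolyXn mcoeffX.
  case: ((U_(i) *+ b.+1)%MM =P m) => [<- _|_]; last by rewrite mulr0 eqxx.
  by rewrite mulmnE mnm1E eq_sym conj_ix_neq.
apply: eq_from_tnth => j; rewrite kickX tnth_mktuple.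
by case: eqP => [->|_]; rewrite ?scale1r // scale0r addr0.
Qed.

End Bracket.

(** * Iterated finite differences of powers *)

Section FiniteDifference.
Variable R : comNzRingType.
Implicit Types (s : seq R) (f g : R -> R).

Fixpoint fdiff s f : R -> R :=
  if s is z :: s' then fdiff s' (fun w => f (w + z) - f w) else f.

Lemma eq_fdiff s f g : f =1 g -> fdiff s f =1 fdiff s g.
Proof. by elim: s f g => //= z s IHs f g fg; apply: IHs => w; rewrite !fg. Qed.

Lemma fdiff_sum s (I : finType) (c : I -> R) (F : I -> R -> R) w :
  fdiff s (fun x => \sum_i c i * F i x) w = \sum_i c i * fdiff s (F i) w.
Proof.
elim: s F w => //= z s IHs F w.
rewrite -(IHs (fun i x => F i (x + z) - F i x)); apply: eq_fdiff => x.
by rewrite -sumrB; apply: eq_bigr => i _; rewrite mulrBr.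
Qed.

(** Each difference with step [z] lowers the degree by one and multiplies the leading coefficient by
    [z] times the current exponent. After [size s] steps a smaller power is gone, and the power
    [size s] leaves a constant independent of [w]. *)
Lemma fdiff_exp s e w : (e <= size s)%N ->
  fdiff s (fun x => x ^+ e) w = (e`!%:R * \prod_(z <- s) z) *+ (e == size s).
Proof.
elim: s e w => [|z s IHs] e w /=.
  by rewrite leqn0 => /eqP->; rewrite big_nil !expr0 mulr1.
move=> es; pose c (i : 'I_e) := z ^+ i.+1 *+ 'C(e, i.+1).
rewrite (@eq_fdiff _ _ (fun x => \sum_i c i * x ^+ (e - i.+1))) => [|x]; last first.
  rewrite exprDn big_ord_recl /= subn0 expr0 mulr1 bin0 mulr1n addrC addKr.
  by apply: eq_bigr => i _; rewrite /c mulrnAl mulrC.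
rewrite fdiff_sum; case: e es @c => [|e] es c; first by rewrite big_ord0.
(* Of the binomial expansion only the term of degree one less can survive the remaining steps; lower
   powers are killed by induction. *)
rewrite ltnS in es; rewrite big_ord_recl big1 => [|i _]; rewrite IHs.
- rewrite subSS subn0 addr0 /c /= expr1 bin1 eqSS big_cons factS natrM.
  rewrite -mulr_natr -[in RHS]mulrnAr -[in RHS]mulrnAr.
  case: (e == size s); rewrite ?mulr0n ?mulr0 // !mulr1n; ring.
- by rewrite subSS (leq_trans _ es) // leq_subr.
- rewrite subSS /= /bump leq0n add1n ltn_eqF ?mulr0n ?mulr0 //.
  by apply: leq_trans es; rewrite ltn_subrL /= (leq_ltn_trans _ (ltn_ord i)).
by rewrite subSS (leq_trans _ es) // leq_subr.
Qed.

(** An iterated difference is built by subtractions from values of [f] at the base point translated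
    by steps of [s], all of which stay in [L]. *)
Lemma fdiff_closed (L P : R -> Prop) s f :
    (forall x z, z \in s -> L x -> L (x + z)) ->
    (forall x y, P x -> P y -> P (x - y)) ->
  (forall x, L x -> P (f x)) -> forall x, L x -> P (fdiff s f x).
Proof.
move=> Ls PB; elim: s Ls f => [|z s IHs] Ls f Pf x Lx /=; first exact: Pf.
apply: IHs Lx => [y t ts|y Ly]; first by apply: Ls; rewrite inE ts orbT.
by apply: PB; apply: Pf => //; apply: Ls => //; rewrite mem_head.
Qed.

End FiniteDifference.

(** * Hamiltonians realized by tame symplectomorphisms *)

Section Realizable.
Variables (K : fieldType) (n : nat).
Hypotheses (charK0 : [pchar K] =i pred0) (n_gt0 : (0 < n)%N).
Implicit Types (f g h F : {mpoly K[n + n]}) (phi psi rho : endo K (n + n)).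
Implicit Types (i j k : 'I_(n + n)) (A : 'M[K]_(n + n)).

(** With [v = u - z_i], take the transvection sending [z] to [z + d {v, z} v], where [d] is the
    inverse of [{v, z_i}]: it sends [z_i] to [z_i + v = u]. Up to sign [{v, z_i}] is the coefficient
    of [u] at the conjugate of [i], hence nonzero. *)
Lemma transvection i (u : 'I_(n + n) -> K) : u (conj_ix i) != 0 ->
  exists2 A, symplectic A & lform (A^~ i) = lform u.
Proof.
move=> ui; pose v k := u k - (k == i)%:R.
pose b j := conj_sign K j * v (conj_ix j); pose d := (b i)^-1.
have bE j : bracket (lform v) 'X_j = (b j)%:MP.
  by rewrite bracket_var lform_mderiv -mul_mpolyC -mpolyCM.
pose A := \matrix_(k, j) ((k == j)%:R + d * b j * v k).
have AE j : lform (A^~ j) = 'X_j + (d * b j) *: lform v.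
  by rewrite -lform_var lformZ lformD; apply: eq_lform => k; rewrite mxE.
exists A.
  apply/symplecticP => j k; rewrite !AE.
  rewrite !(bracketDl, bracketDr, bracketZl, bracketZr) bracketff !scaler0 addr0.
  rewrite [bracket 'X_j (lform v)]bracketC !bE -addrA scalerN -!mul_mpolyC -!mpolyCM.
  by rewrite mulrAC addNr addr0.
rewrite AE mulVf ?scale1r; last first.
  rewrite /b /v conj_ix_neq subr0 mulf_neq0 //.
  by apply/eqP => s0; have /eqP := conj_sign_sqr K i; rewrite s0 mul0r eq_sym oner_eq0.
by rewrite -lform_var lformD; apply: eq_lform => k; rewrite addrC subrK.
Qed.

(** The map [id + {F, _}] is the flow of [F] at time one to first order; only its agreement with a
    tame map below order [a + 1] is required. *)
Definition realizable a F := ord_ge a.+1 F /\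
  exists phi psi, tame_inverse phi psi /\
    forall i, ord_ge a.+1 (tnth phi i - 'X_i - bracket F 'X_i).

(** As [A] preserves the bracket and sends ['X_i] to [lform u], conjugating [kick] by it gives
    exactly [id + {F, _}] for the stated [F]; the remainder is zero. *)
Lemma realizable_pow b c i (u : 'I_(n + n) -> K) : u (conj_ix i) != 0 ->
  realizable b.+1 (c *: lform u ^+ b.+2).
Proof.
move=> /transvection[A AS Au]; split.
  by apply: ord_geZ; rewrite -[X in ord_ge X]muln1; apply/ord_ge_exp/ord_ge_lform.
have [B AB] := linear_change_tame AS; have kT := kick_tame c i b.
exists (endo_comp (linear_change A) (endo_comp (kick (c *: 'X_i ^+ b.+2)) (linear_change B))).
exists (endo_comp (endo_comp (linear_change A) (kick (- c *: 'X_i ^+ b.+2))) (linear_change B)).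
split.
  exact: (tame_inverse_comp AB (tame_inverse_comp kT (tame_inverse_sym AB))).
move=> j; rewrite !tnth_mktuple -/(tnth _ _).
have -> : \sum_(i < n + n) B i j *: 'X_i = lform (B^~ j) by [].
rewrite endo_app_lform; under eq_bigr do rewrite tnth_mktuple scalerDr.
rewrite big_split /= -bracket_lformr -/(lform _).
rewrite /endo_app raddfD /= -!/(endo_app _ _) (tame_inverse_bracket AB).
rewrite -tnth_linear_change -endo_appX (endo_appK (tame_inverseV AB)).
rewrite [_ + _ - 'X_j]addrC addKr /endo_app linearZ /= rmorphXn /= -/(endo_app _ _) endo_appX.
by rewrite tnth_linear_change Au subrr; apply: ord_ge0.
Qed.

Lemma realizable_high a F : ord_ge a.+2 F -> realizable a F.
Proof.
move=> Fa; split; first exact: ord_ge_le Fa.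
exists (endo_id K (n + n)), (endo_id K (n + n)); split=> [|i].
  exact: tame_inverse_id.
rewrite tnth_mktuple subrr sub0r bracket_var.
exact/ord_geN/ord_geZ/ord_ge_mderiv.
Qed.

(** Composition adds the increments, except that the second one is evaluated at the first map. This
    changes it by terms of order [2a - 1], which is at least [a + 1] precisely because [a > 1]. *)
Lemma realizableD a F G : (1 < a)%N ->
  realizable a F -> realizable a G -> realizable a (F + G).
Proof.
move=> a1 [Fa [phi1 [psi1 [T1 E1]]]] [Ga [phi2 [psi2 [T2 E2]]]].
split; first exact: ord_geD.
exists (endo_comp phi1 phi2), (endo_comp psi2 psi1).
split=> [|i]; first exact: tame_inverse_comp.
rewrite tnth_mktuple bracketDl; set x := bracket F _; set y := bracket G _.
pose r := tnth phi2 i - 'X_i - y.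
have -> : tnth phi2 i = 'X_i + y + r by rewrite /r; ring.
rewrite /endo_app 2!raddfD /= -!/(endo_app _ _) endo_appX.
have -> : tnth phi1 i + endo_app phi1 y + endo_app phi1 r - 'X_i - (x + y) =
    (tnth phi1 i - 'X_i - x) + (endo_app phi1 y - y) + endo_app phi1 r by ring.
have phi10 := tame_inverse_originl T1.
have br_ord H j : ord_ge a.+1 H -> ord_ge a (bracket H 'X_j).
  by move=> Ha; rewrite bracket_var; apply/ord_geZ/ord_ge_mderiv.
apply: ord_geD; last exact: (ord_ge_app phi10 (E2 i)).
apply: ord_geD; first exact: E1.
apply: (@ord_ge_le _ _ _ (a + a).-1).
  by case: a a1 {Fa Ga E1 E2 br_ord} => [|[|a]] // _; rewrite addSn /= !addnS !ltnS leq_addr.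
apply: ord_ge_app_sub; [exact: ltnW| |exact: br_ord].
move=> j; rewrite -[X in ord_ge _ X](subrK (bracket F 'X_j)).
by apply: ord_geD; [exact: ord_ge_le (E1 j)|exact: br_ord].
Qed.

Lemma natr_neq0 (e : nat) : e.+1%:R != 0 :> K.
Proof. by have /pcharf0P-> := charK0. Qed.

Lemma mpolyX_seq (N : nat) (m : 'X_{1..N}) :
  exists2 s : seq 'I_N, size s = mdeg m & 'X_[K, m] = \prod_(i <- s) 'X_i.
Proof.
elim/mpolyX_ind: m => [|i m [s sm mE]].
  by exists [::]; rewrite ?mdeg0 // big_nil mpolyX0.
by exists (i :: s); rewrite /= ?mdegD ?mdeg1 ?sm // big_cons mpolyXD mE.
Qed.

Lemma realizableX b c m : mdeg m = b.+3 -> realizable b.+2 (c *: 'X_[m]).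
Proof.
move=> mb; have [s sm mE] := mpolyX_seq m.
pose i0 : 'I_(n + n) := ix (Ordinal n_gt0).
(* Forms whose coefficient at [p_1] is a positive integer: adding variables preserves this, and
   characteristic zero keeps the coefficient nonzero, as the transvection requires. *)
pose L f := exists u (e : nat), f = lform u /\ u (conj_ix i0) = e.+1%:R.
(* Quantifying over every scalar [d] makes [P] closed under subtraction. *)
pose P f := forall d, realizable b.+2 (d *: f).
have PB f g : P f -> P g -> P (f - g).
  by move=> Pf Pg d; rewrite scalerBr -scaleNr; apply: realizableD.
have LX f g : g \in map (fun i : 'I_(n + n) => 'X_i) s -> L f -> L (f + g).
  case/mapP => j _ -> [u [e [-> ue]]].
  exists (fun i => u i + (i == j)%:R), (e + (conj_ix i0 == j))%N; split.
    by rewrite -lformD lform_var.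
  by rewrite ue -natrD addSn.
have LP f : L f -> P (f ^+ b.+3).
  by move=> [u [e [-> ue]]] d; apply: (@realizable_pow _ _ i0); rewrite ue natr_neq0.
have LX0 : L 'X_(conj_ix i0).
  exists (fun k => (k == conj_ix i0)%:R), 0%N; split; first by rewrite lform_var.
  by rewrite eqxx.
(* Differencing [w ^ (b + 3)] at [p_1], with the variables of [m] as steps, gives [(b + 3)!] times
   the monomial; the scalar [d] absorbs the factorial. *)
have := fdiff_closed LX PB LP LX0.
rewrite fdiff_exp size_map sm mb // eqxx mulr1n big_map -mE => /(_ (c / (b.+3)`!%:R)).
rewrite mulr_natl -scaler_nat scalerA divfK //.
by case: (_`!) (fact_gt0 b.+3) => // e _; apply: natr_neq0.
Qed.

Lemma realizableP a F : (1 < a)%N -> ord_ge a.+1 F -> realizable a F.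
Proof.
move=> a1; apply: (@mpolyX_ord_ind _ _ a.+1 (realizable a)) => [|G H|c m am].
- by apply: realizable_high; apply: ord_ge0.
- exact: realizableD.
move: am; rewrite leq_eqVlt => /predU1P[ma|am].
  by case: a a1 ma => [|[|a]] // _ ma; apply: realizableX.
by apply: realizable_high; apply/ord_geZ/(ord_ge_le am)/ord_geX.
Qed.

(* Poincare lemma for a 1-form closed up to higher order, in Hamiltonian form. *)
Lemma hamiltonian_exists a (g : 'I_(n + n) -> {mpoly K[n + n]}) :
    (forall i, ord_ge a (g i)) ->
    (forall i j, ord_ge a (bracket (g i) 'X_j + bracket 'X_i (g j))) ->
  exists2 F, ord_ge a.+1 F & forall i, ord_ge a.+1 (g i - bracket F 'X_i).
Proof.
(* If [g i] were [{F, z_i}], then [G k] would be the derivative of [F] in [z_k]. *)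
move=> ga gB; pose G k := - conj_sign K k *: g (conj_ix k).
have Ga k : ord_ge a (G k) by apply: ord_geZ.
have Gclosed j k : ord_ge a ((G k)^`M(j) - (G j)^`M(k)).
  have := ord_geZ (conj_sign K j * conj_sign K k) (gB (conj_ix k) (conj_ix j)).
  rewrite [bracket 'X_ _ _]bracketC !bracket_var !conj_ixK !conj_sign_conj.
  rewrite scalerDr scalerN !scalerA /G !mderivZ !mulrN.
  rewrite mulrAC conj_sign_sqr -mulrA conj_sign_sqr mulr1 mul1r.
  by rewrite !scaleNr.
(* The radial primitive of the 1-form [G]: integrating degree [a] coefficients along rays from the
   origin yields the factor [1 / (a + 1)]. *)
exists (a.+1%:R^-1 *: \sum_k 'X_k * G k).
  apply/ord_geZ/ord_ge_sum => k _; rewrite -add1n.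
  by apply: ord_geM => //; apply: ord_ge_var.
move=> i; rewrite bracket_var; set j := conj_ix i.
have -> : g i = conj_sign K i *: G j.
  by rewrite /G conj_ixK conj_sign_conj opprK scalerA conj_sign_sqr scale1r.
rewrite -scalerBr; apply: ord_geZ.
have -> : G j = a.+1%:R^-1 *: (G j *+ a.+1).
  by rewrite -scaler_nat scalerA mulVf ?scale1r // natr_neq0.
rewrite mderivZ -scalerBr; apply: ord_geZ.
have -> : (\sum_k 'X_k * G k)^`M(j) = G j + \sum_k 'X_k * (G k)^`M(j).
  rewrite raddf_sum /=; under eq_bigr do rewrite mderivM mderiv_var.
  rewrite big_split /= (bigD1 j) //= eqxx mul1r big1 ?addr0 // => k kj.
  by rewrite (negPf kj) mul0r.
(* Closedness exchanges the derivative of [G k] in [z_j] for that of [G j] in [z_k], after which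
   Euler's formula applies to [G j]. *)
have -> : G j *+ a.+1 - (G j + \sum_k 'X_k * (G k)^`M(j)) =
    - (\sum_k 'X_k * (G j)^`M(k) - G j *+ a)
    - \sum_k 'X_k * ((G k)^`M(j) - (G j)^`M(k)).
  have -> : \sum_k 'X_k * ((G k)^`M(j) - (G j)^`M(k)) =
      \sum_k 'X_k * (G k)^`M(j) - \sum_k 'X_k * (G j)^`M(k).
    by rewrite -sumrB; apply: eq_bigr => k _; rewrite mulrBr.
  by rewrite mulrS; ring.
apply: ord_geB; first exact/ord_geN/ord_ge_euler.
by apply: ord_ge_sum => k _; rewrite -add1n; apply: ord_geM => //; apply: ord_ge_var.
Qed.

(** * Successive approximation, one order at a time *)

Lemma improve_approximation a rho : (1 < a)%N -> preserves_bracket rho ->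
    (forall i, ord_ge a (tnth rho i - 'X_i)) ->
  exists phi psi, tame_inverse phi psi /\
    forall i, ord_ge a.+1 (tnth (endo_comp psi rho) i - 'X_i).
Proof.
move=> a1 rhoB rhoa; pose g i := tnth rho i - 'X_i.
have [|F Fa FE] := @hamiltonian_exists a g rhoa.
  (* Expanding [{z_i + g i, z_j + g j} = {z_i, z_j}] leaves the quadratic term [{g i, g j}], of
     order [2a - 2], which is at least [a] since [a > 1]. *)
  move=> i j; have -> : bracket (g i) 'X_j + bracket 'X_i (g j) = - bracket (g i) (g j).
    have := rhoB 'X_i 'X_j; rewrite bracket_vars /endo_app comp_mpolyC.
    rewrite -!/(endo_app _ _) !endo_appX -bracket_vars.
    rewrite /g !(bracketBl, bracketBr) => ->; ring.
  apply/ord_geN; case: a a1 rhoa => [|[|a]] // _ rhoa.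
  apply: (@ord_ge_le _ _ _ (a.+1 + a.+1)); first by rewrite addSn addnS !ltnS leq_addl.
  by apply: ord_ge_bracket; apply: rhoa.
have [_ [phi [psi [T phiE]]]] := realizableP a1 Fa.
exists phi, psi; split=> // i; rewrite tnth_mktuple.
(* Writing ['X_i] as [psi] applied to its image under [phi] turns the error into [psi] of
   [rho - phi], and [psi] keeps orders. *)
rewrite -[X in _ - X](endo_appK (tame_inverseK T)) endo_appX /endo_app -raddfB /=.
apply: (ord_ge_app (tame_inverse_originr T)).
rewrite -[X in ord_ge _ X](subrK (g i - bracket F 'X_i)).
apply: ord_geD; last exact: FE.
have -> : tnth rho i - tnth phi i - (g i - bracket F 'X_i) =
  - (tnth phi i - 'X_i - bracket F 'X_i) by rewrite /g; ring.
exact/ord_geN/phiE.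
Qed.

Lemma tame_approximation (sigma : endo K (n + n)) d :
    preserves_bracket sigma -> origin_preserving sigma ->
  exists tau, tame tau /\ forall i, ord_ge d (tnth tau i - tnth sigma i).
Proof.
move=> sigmaB sigma0.
(* Invariant of the induction: [sigma] is [tau] after a remainder [rho] tangent to the identity. The
   offset 2 is the order reached at [d = 0] by removing the linear part; then [tau - sigma] is [tau]
   applied to [id - rho]. *)
suff [tau [taui [rho [T rhoB rhoX sigmaE]]]] : exists tau taui rho,
    [/\ tame_inverse tau taui, preserves_bracket rho,
        forall i, ord_ge d.+2 (tnth rho i - 'X_i) & sigma = endo_comp tau rho].
  exists tau; split=> [|i]; first exact: tame_inverse_tame T.
  rewrite sigmaE tnth_mktuple -endo_appX /endo_app -raddfB -opprB /=.
  rewrite -/(endo_app _ _); apply: (ord_ge_app (tame_inverse_originl T)).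
  by apply/ord_geN/(ord_ge_le _ (rhoX i)); rewrite -addn2 leq_addr.
elim: d => [|d [tau [taui [rho [T rhoB rhoX sigmaE]]]]]; last first.
  have [//|phi [psi [T' rhoX']]] := improve_approximation _ rhoB rhoX.
  exists (endo_comp tau phi), (endo_comp psi taui), (endo_comp psi rho); split.
  - exact: (tame_inverse_comp T T').
  - exact: preserves_bracket_comp (tame_inverse_bracket (tame_inverse_sym T')) rhoB.
  - exact: rhoX'.
  apply: eq_from_tnth => i; rewrite sigmaE !tnth_mktuple endo_app_comp.
  by rewrite (endo_appK (tame_inverseV T')).
pose A := \matrix_(k, j) (tnth sigma j)@_U_(k).
have sigmaA i : ord_ge 2 (tnth sigma i - lform (A^~ i)).
  move=> m; rewrite ltnS leq_eqVlt ltnS leqn0 => /orP[/mdeg1P[k /eqP->]|].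
    rewrite mcoeffB raddf_sum (bigD1 k) //= big1 ?addr0 => [|l lk].
      by rewrite mcoeffZ mcoeffXU eqxx mulr1 mxE subrr.
    by rewrite mcoeffZ mcoeffXU (negPf lk) mulr0.
  rewrite mdeg_eq0 => /eqP->; rewrite mcoeffB sigma0 (@ord_ge_lform _ _ (A^~ i)) ?subrr //.
  by rewrite mdeg0.
have AS : symplectic A.
  apply/symplecticP => i j.
  (* Nonlinear terms contribute nothing to the constant term of a bracket of two images, so the
     linear parts have the same brackets as the variables. *)
  have lowE : ord_ge 1 (bracket (lform (A^~ i)) (lform (A^~ j)) - bracket 'X_i 'X_j).
    have := sigmaB 'X_i 'X_j; rewrite {1}bracket_vars /endo_app comp_mpolyC.
    rewrite -!/(endo_app _ _) !endo_appX -bracket_vars => ->.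
    set x := lform _; set y := lform _.
    pose x' := tnth sigma i - x; pose y' := tnth sigma j - y.
    have -> : tnth sigma i = x + x' by rewrite /x'; ring.
    have -> : tnth sigma j = y + y' by rewrite /y'; ring.
    have -> : bracket x y - bracket (x + x') (y + y') =
        - (bracket x y' + bracket x' y + bracket x' y').
      by rewrite !(bracketDl, bracketDr); ring.
    have [x1 y1] : ord_ge 1 x /\ ord_ge 1 y by split; apply: ord_ge_lform.
    apply/ord_geN/ord_geD; first apply: ord_geD.
    - exact: ord_ge_bracket x1 (sigmaA j).
    - exact: ord_ge_bracket (sigmaA i) y1.
    by apply: (@ord_ge_le _ _ _ (1 + 1)) => //; exact: ord_ge_bracket (sigmaA i) (sigmaA j).
  have := lowE 0%MM; rewrite mdeg0 mcoeffB bracket_lform bracket_vars !mpolyCK.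
  by move=> /(_ isT)/eqP; rewrite subr_eq0 => /eqP->.
have [B AB] := linear_change_tame AS.
exists (linear_change A), (linear_change B), (endo_comp (linear_change B) sigma); split.
- exact: AB.
- exact: preserves_bracket_comp (tame_inverse_bracket (tame_inverse_sym AB)) sigmaB.
- move=> i; rewrite tnth_mktuple -[X in _ - X](endo_appK (tame_inverseK AB)) endo_appX.
  rewrite tnth_linear_change /endo_app -raddfB /=.
  exact: (ord_ge_app (tame_inverse_originr AB)).
apply: eq_from_tnth => i; rewrite !tnth_mktuple.
by rewrite (endo_appK (tame_inverseV AB)).
Qed.

End Realizable.

(** * From orders of vanishing to convergence in the power series metric *)

Lemma height_ord_ge (K : fieldType) N d (f : {mpoly K[N]}) k :
  ord_ge d f -> height f = Some k -> (d <= k)%N.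
Proof.
move=> fd /height_Some[+ _]; rewrite leqNgt; apply: contraNN => kd.
rewrite pihomogE big_seq_cond big1 // => m /andP[fm /eqP dm].
by rewrite fd ?dm // scale0r.
Qed.

Lemma dist_ord_ge (K : fieldType) N d (phi psi : endo K N) :
    (forall i, ord_ge d (tnth phi i - tnth psi i)) ->
  Rle (dist phi psi) (exp (Ropp (INR d))).
Proof.
move=> phid; rewrite /dist.
(* For infinite height this is vacuous, and the distance is then zero. *)
have : forall k, height_tuple (endo_sub phi psi) = Some k -> (d <= k)%N.
  rewrite /height_tuple; elim/big_ind: _ => // [[k1|] [k2|] //= H1 H2 k [<-]|i _ k].
    by rewrite leq_min H1 ?H2.
  by rewrite tnth_mktuple; apply: height_ord_ge.
case: height_tuple => [k|] dk; last exact/Rlt_le/exp_pos.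
have /leP/le_INR/Ropp_le_contravar := dk k erefl.
case/Rle_lt_or_eq_dec => [/exp_increasing/Rlt_le //|->]; exact: Rle_refl.
Qed.

Lemma dist_ge0 (K : fieldType) N (phi psi : endo K N) : Rle (IZR 0) (dist phi psi).
Proof. by rewrite /dist; case: height_tuple => [k|]; [exact/Rlt_le/exp_pos|exact: Rle_refl]. Qed.

(** Choose [N] with [1 / N < eps]; for [k >= N], [exp k >= 1 + k > N]. *)
Lemma exp_opp_INR_cvg eps : Rlt (IZR 0) eps ->
  exists N, forall k, (N <= k)%N -> Rlt (exp (Ropp (INR k))) eps.
Proof.
move=> eps0; have [N [Neps N0]] := archimed_cor1 eps eps0.
exists N => k /leP/le_INR Nk; apply: Rlt_trans Neps.
rewrite exp_Ropp; apply: Rinv_lt_contravar.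
  by apply: Rmult_lt_0_compat; [exact: lt_0_INR|exact: exp_pos].
apply: Rle_lt_trans Nk _; apply: Rlt_le_trans (exp_ineq1_le _).
rewrite Rplus_comm; exact: Rlt_plus_1.
Qed.

Theorem theorem1p2p9 (K : fieldType) (charK0 : [pchar K] =i pred0)
    (n : nat) (n_gt0 : (0 < n)%N) (sigma : endo K (n + n))
    (sigma_sympl : symplectomorphism sigma)
    (sigma_origin : origin_preserving sigma)
    (sigma_jac : Jacobian sigma = 1) :
  exists tau : nat -> endo K (n + n),
    (forall k, tame (tau k)) /\ converges_to tau sigma.
Proof.
have [_ sigmaB] := sigma_sympl.
have approx k := tame_approximation charK0 n_gt0 k sigmaB sigma_origin.
(* Choice collects the approximations of each order [k] into a sequence, whose distance to [sigma]
   at [k] is at most [exp (- k)]. *)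
have [tau tauP] := functional_choice _ approx.
exists tau; split=> [k|eps eps0]; first by case: (tauP k).
have [N Neps] := exp_opp_INR_cvg eps0; exists N => k /leP Nk.
rewrite /Rdist Rminus_0_r Rabs_pos_eq; last exact: dist_ge0.
by apply: Rle_lt_trans (Neps k Nk); apply: dist_ord_ge; case: (tauP k).
Qed.
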